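(* Let $X$ be a Banach space and $T:X\to X$ a bounded linear operator. Assume there exist a double sequence $\{u_{k,n}\}_{k\in\mathbb{N},n\in\mathbb{Z}}$ of elements of $X$ and an infinite set $A\subseteq\mathbb{N}$ such that: (A1) $\{u_{k,0}:k\in\mathbb{N}\}$ is dense in $X$; (A2) $Tu_{k,n}=u_{k,n+1}$ for every $k\in\mathbb{N}$, $n\in\mathbb{Z}$; (A3) the ($T$-invariant) linear space $E=\operatorname{span}\{u_{k,n}:n\in\mathbb{Z}_+,k\in\mathbb{N}\}$ carries an inner product $\langle\cdot,\cdot\rangle$ such that the topology on $E$ defined by $\|x\|_0=\sqrt{\langle x,x\rangle}$ is (not necessarily strictly) stronger than the one inherited from the norm of $X$; (A4) for every $k\in\mathbb{N}$, $\lim_{n\to\infty,\,n\in A}\|u_{k,-n}\|=0$; (A5) for every $k\in\mathbb{N}$ the sequence $\{\|u_{k,n}\|_0\}_{n\in\mathbb{Z}_+}$ is bounded, and for every $k,a\in\mathbb{N}$, $b\in\mathbb{Z}_+$, $s\in A$, $\lim_{n\to\infty,\,n\in A}\langle u_{k,n-s},u_{a,b}\rangle=0$; (A6) for every $k,m\in\mathbb{N}$ and $s\in A$, $\displaystyle\lim_{t\to\infty,\,t\in A,\,t>s}\ \limsup_{n\to\infty,\,n\in A,\,n>t}|\langle u_{k,n-s},u_{m,n-t}\rangle|=0$. Then $T$ is weakly hypercyclic.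
   Context: Scalars $\mathbb{K}\in\{\mathbb{R},\mathbb{C}\}$; $\mathbb{Z}_+=\{0,1,2,\dots\}$; $\|\cdot\|$ is the norm of $X$. $T$ is weakly hypercyclic if there is $x\in X$ such that $\{T^nx:n\in\mathbb{Z}_+\}$ is dense in $X$ with respect to the weak topology. *)

(* Defs.v *)
From HB Require Import structures.
From mathcomp Require Import all_boot all_order all_algebra.
From mathcomp Require Import all_classical all_reals all_analysis.
From mathcomp Require Import complex.
Set Implicit Arguments. Unset Strict Implicit. Unset Printing Implicit Defensive.
Import Order.TTheory GRing.Theory Num.Theory.
Import numFieldNormedType.Exports.
Local Open Scope classical_set_scope.
Local Open Scope ring_scope.

Definition is_linear_map (K : numFieldType) (V W : lmodType K) (f : V -> W) :=
  forall (a : K) (x y : V), f (a *: x + y) = a *: f x + f y.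

(* Density of the orbit {T^n x : n in Z_+} in the weak topology of X:
   every basic weak neighbourhood
     { z : |f_i (z - y)| < eps, i < m }
   (y in X, f_1..f_m continuous linear functionals, eps > 0)
   meets the orbit. *)
Definition weakly_hypercyclic (K : numFieldType) (X : normedModType K)
    (T : X -> X) : Prop :=
  exists x : X, forall (y : X) (m : nat) (f : 'I_m -> X -> K),
    (forall i, @is_linear_map K X K^o (f i) /\ continuous (f i)) ->
    forall eps : K, 0 < eps ->
    exists n : nat, forall i, `|f i (iter n T x - y)| < eps.

Definition lim0_along (K : numFieldType) (A : set nat) (f : nat -> K) : Prop :=
  forall eps : K, 0 < eps ->
    exists N : nat, forall n : nat, A n -> (N < n)%N -> `|f n| < eps.

Definition span_u (K : numFieldType) (X : lmodType K) (u : nat -> int -> X)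
    (x : X) : Prop :=
  exists (m : nat) (c : 'I_m -> K) (k j : 'I_m -> nat),
    x = \sum_(i < m) c i *: u (k i) (Posz (j i)).

(* ip is an inner product on the subspace E (conj = complex conjugation
   of the scalar field, identity in the real case). *)
Definition inner_product_on (K : numFieldType) (X : lmodType K)
    (conj : K -> K) (E : X -> Prop) (ip : X -> X -> K) : Prop :=
  [/\ forall (a : K) (x y z : X), E x -> E y -> E z ->
        ip (a *: x + y) z = a * ip x z + ip y z,
      forall x y : X, E x -> E y -> ip y x = conj (ip x y)
    & forall x : X, E x -> x != 0 -> 0 < ip x x].

Definition theorem4p4_over (K : numFieldType) (conj : K -> K) : Prop :=
  forall (X : completeNormedModType K) (T : X -> X),
    is_linear_map T -> continuous T ->
  forall (u : nat -> int -> X) (A : set nat) (ip : X -> X -> K),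
    infinite_set A ->
    dense (range (fun k : nat => u k 0%Z)) ->
    (forall (k : nat) (n : int), T (u k n) = u k (n + 1)%R) ->
    inner_product_on conj (span_u u) ip ->
    (forall x : X, span_u u x -> forall eps : K, 0 < eps ->
       exists2 delta : K, 0 < delta &
         forall y : X, span_u u y ->
           `|ip (y - x) (y - x)| < delta -> `|y - x| < eps) ->
    (forall k : nat, lim0_along A (fun n => `|u k (- (Posz n))%R|)) ->
    (forall k : nat, exists M : K, forall n : nat,
        `|ip (u k (Posz n)) (u k (Posz n))| <= M) ->
    (forall (k a b s : nat), A s ->
        lim0_along A (fun n => ip (u k (Posz n - Posz s)%R) (u a (Posz b)))) ->
    (forall (k m s : nat), A s ->
       forall eps : K, 0 < eps ->
       exists T0 : nat, forall t : nat, A t -> (s < t)%N -> (T0 < t)%N ->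
         exists N : nat, forall n : nat, A n -> (t < n)%N -> (N < n)%N ->
           `|ip (u k (Posz n - Posz s)%R) (u m (Posz n - Posz t)%R)| < eps) ->
    weakly_hypercyclic T.

(* Main.v *)
Require Import Defs.
From HB Require Import structures.
From mathcomp Require Import all_boot all_order all_algebra.
From mathcomp Require Import all_classical all_reals all_analysis.
From mathcomp Require Import complex.
From mathcomp Require Import zify ring.
Import Order.TTheory GRing.Theory Num.Theory.
Import numFieldNormedType.Exports.
Local Open Scope ring_scope.
Set Implicit Arguments.
Unset Strict Implicit.
Unset Printing Implicit Defensive.

(* The hypercyclic vector is x = sum_j u_{kappa j, -nu j} with return times
   nu j in A growing so fast that T^(nu j) x = u_{kappa j, 0} + y_j + o(1), where
   y_j = sum_(l < j) u_{kappa l, nu j - nu l} lies in E.  By (A5) and (A6) the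
   y_j, and the summands of each y_j, are almost orthogonal for the inner product,
   so |<y_j, y_j>| <= C_j with C_j growing like sum_(l < j) sup_n |u_{kappa l, n}|_0^2.
   A functional f continuous on X is |.|_0-continuous on E, hence a Bessel
   inequality gives sum_j |f(y_j)|^2 / C_j < oo.  If kappa is chosen so that
   sum_(kappa j = k) 1 / C_j = oo for every k, finitely many functionals are
   simultaneously small at some y_j with kappa j = k and j large, so u_{k, 0} is
   a weak limit point of the orbit of x. *)

(** * Eventual properties along [A] and recursive selection *)

Definition eventually_along (A : set nat) (Q : nat -> Prop) : Prop :=
  exists N : nat, forall n : nat, A n -> (N < n)%N -> Q n.

Lemma eventually_along_imp (A : set nat) (Q Q' : nat -> Prop) :
  (forall n, A n -> Q n -> Q' n) -> eventually_along A Q -> eventually_along A Q'.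
Proof. by move=> QQ' [N HN]; exists N => n An Nn; apply/QQ'/HN. Qed.

Lemma eventually_along_and (A : set nat) (Q Q' : nat -> Prop) :
  eventually_along A Q -> eventually_along A Q' ->
  eventually_along A (fun n => Q n /\ Q' n).
Proof.
move=> [N HN] [N' HN']; exists (maxn N N') => n An.
by rewrite gtn_max => /andP[? ?]; split; [exact: HN | exact: HN'].
Qed.

Lemma eventually_along_gt (A : set nat) (m : nat) :
  eventually_along A (fun n => (m < n)%N).
Proof. by exists m. Qed.

Lemma eventually_along_forall (A : set nat) (Q : nat -> nat -> Prop) (m : nat) :
  (forall i, (i < m)%N -> eventually_along A (Q i)) ->
  eventually_along A (fun n => forall i, (i < m)%N -> Q i n).
Proof.
elim: m => [|m IH] H; first by exists 0%N.
have /eventually_along_and/(_ (H m (ltnSn m))) := IH (fun i im => H i (ltnW im)).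
apply: eventually_along_imp => n _ [Hn Qm] i.
by rewrite ltnS leq_eqVlt => /orP[/eqP -> //|]; exact: Hn.
Qed.

Lemma infinite_set_gt (A : set nat) (N : nat) :
  infinite_set A -> exists2 n, A n & (N < n)%N.
Proof.
move=> infA; apply: contrapT => noA; apply: infA.
apply: (@sub_finite_set _ _ `I_N.+1); last exact: finite_II.
move=> n An /=; rewrite ltnNge; apply/negP => Nn; apply: noA; by exists n.
Qed.

(** Dependent choice with full memory: the condition on each new value may involve the list of all
    earlier ones. A step function chosen on all lists is iterated, with membership in [A] as the
    invariant. *)
Lemma recursive_selection (A : set nat) (P : seq nat -> nat -> Prop) :
  infinite_set A ->
  (forall s, (forall i, i \in s -> A i) -> eventually_along A (P s)) ->
  exists nu : nat -> nat, forall j, A (nu j) /\ P (mkseq nu j) (nu j).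
Proof.
move=> infA HP.
have step s : exists n, (forall i, i \in s -> A i) -> A n /\ P s n.
  (* Lists that leave [A] get the dummy value 0, so that the step is total. *)
  have [As|nAs] := pselect (forall i, i \in s -> A i); last by exists 0%N.
  have [N HN] := HP s As; have [n An Nn] := infinite_set_gt N infA.
  by exists n => _; split => //; exact: HN.
have [f Hf] := choice step.
pose S := fix S j := if j is j'.+1 then rcons (S j') (f (S j')) else [::].
have SE j : S j = mkseq (fun i => f (S i)) j.
  by elim: j => // j IH; rewrite mkseqS -IH.
have AS j : forall i, i \in S j -> A i.
  elim: j => //= j IH i; rewrite mem_rcons inE => /orP[/eqP ->|]; last exact: IH.
  by have [] := Hf _ IH.
exists (fun j => f (S j)) => j; rewrite -SE; exact: Hf (AS j).
Qed.

(** * Divergent sums and the index sequence [kappa] *)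

Lemma sum_inv_linear_unbounded (K : numFieldType) (a b B : nat) :
  exists2 M : nat, (0 < M)%N &
    B%:R <= \sum_(0 <= i < M) ((a + b * i).+1%:R)^-1 :> K.
Proof.
pose h M : K := \sum_(0 <= i < M) ((a + b * i).+1%:R)^-1.
suff claim N : exists2 M, (0 < M)%N & N%:R / b.+1%:R <= h M.
  have [M M0 HM] := claim (B * b.+1)%N; exists M => //; apply: le_trans HM.
  by rewrite natrM mulfK ?pnatr_eq0.
elim: N => [|N [M M0 IH]].
  by exists 1%N => //; rewrite mul0r /h big_nat1 invr_ge0 ler0n.
(* With m = a + b M + 1, each of the next m terms is at least 1 / (m (b + 1)), so together they gain
   1 / (b + 1). *)
exists (M + (a + b * M).+1)%N; first by rewrite addnS.
rewrite /h (big_cat_nat (n := M)) ?leq_addr //= -natr1 mulrDl lerD // mul1r.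
set m := (a + b * M).+1.
apply: (@le_trans _ _ (\sum_(M <= i < M + m) ((m * b.+1)%:R)^-1)).
  rewrite sumr_const_nat addKn -[leRHS]mulr_natr natrM invfM mulrAC mulVf ?mul1r //.
  by rewrite pnatr_eq0.
rewrite !big_nat; apply: ler_sum => i /andP[Mi iMm].
rewrite lef_pV2 ?posrE ?ltr0n ?muln_gt0 // ler_nat.
rewrite /m in iMm *; nia.
Qed.

(* The sequence is a concatenation of constant blocks: along a block of value
   k the denominators grow linearly, so by divergence of the harmonic series a
   long enough block contributes as much as we like. *)
Lemma harmonically_frequent_sequence (K : numFieldType) (c : nat -> nat) :
  exists kappa : nat -> nat, forall k B : nat, exists J : nat,
    B%:R <= \sum_(0 <= j < J | kappa j == k)
              ((1 + \sum_(0 <= l < j) c (kappa l))%N%:R)^-1 :> K.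
Proof.
pose C (s : seq nat) : nat := sumn (map c s).
have ext (s : seq nat) (k B : nat) : exists M, (0 < M)%N /\
    B%:R <= \sum_(0 <= i < M) ((C s + c k * i).+1%:R)^-1 :> K.
  by have [M M0 HM] := sum_inv_linear_unbounded K (C s) (c k) B; exists M.
have [m Hm] := choice (fun skB : seq nat * (nat * nat) =>
  ext skB.1 skB.2.1 skB.2.2).
(* Stage [p] serves the pair (k, B) coded by [p], so every pair gets its block; numbers coding no
   pair default to (0, 0). *)
pose kB (p : nat) : nat * nat := odflt (0, 0)%N (unpickle p).
pose S := fix S p := if p is p'.+1
  then S p' ++ nseq (m (S p', kB p')) (kB p').1 else [::].
have sizeS p : (p <= size (S p))%N.
  elim: p => //= p IH; rewrite size_cat size_nseq.
  have [] := Hm (S p, kB p); lia.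
have nthS p q j : (p <= q)%N -> (j < size (S p))%N ->
    nth 0%N (S q) j = nth 0%N (S p) j.
  move=> /subnKC <-; elim: (q - p)%N => [|d IH] jp; first by rewrite addn0.
  rewrite addnS /= nth_cat IH //.
  suff -> : (j < size (S (p + d)))%N by [].
  apply: leq_trans jp _; elim: d {IH} => [|d IH]; first by rewrite addn0.
  by rewrite addnS /= size_cat; apply: leq_trans IH (leq_addr _ _).
(* Blocks are nonempty, so [S j.+1] already has an entry at position [j], and later stages preserve
   it. *)
pose kappa j := nth 0%N (S j.+1) j.
have kappaE p j : (j < size (S p))%N -> kappa j = nth 0%N (S p) j.
  move=> jp; rewrite /kappa; case: (leqP p j.+1) => pj; first exact: nthS.
  by rewrite (nthS j.+1 p j (ltnW pj) (sizeS j.+1)).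
exists kappa => k B.
pose p := pickle (k, B); have kBp : kB p = (k, B) by rewrite /kB pickleK.
exists (size (S p.+1)).
have [] := Hm (S p, kB p); set M := m _ => M0; rewrite kBp /= => HM.
have szS : size (S p.+1) = (size (S p) + M)%N by rewrite /= size_cat size_nseq.
apply: le_trans HM _.
rewrite szS [leRHS](big_cat_nat (n := size (S p))) ?leq_addr //=.
rewrite -[leLHS]add0r lerD //; first by apply: sumr_ge0 => i _; rewrite invr_ge0 ler0n.
rewrite -{1}[size (S p)]add0n big_addn addKn.
have kappa_blk i : (i < M)%N -> kappa (i + size (S p))%N = k.
  move=> iM; rewrite (kappaE p.+1) ?szS; last lia.
  rewrite /= nth_cat ltnNge leq_addl /= addnK nth_nseq -/M iM.
  by rewrite kBp.
(* Inside the block each index adds [c k], so the denominators are exactly those for which the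
   length [M] was chosen. *)
have CE i : (i <= M)%N ->
    (\sum_(0 <= l < i + size (S p)) c (kappa l) = C (S p) + c k * i)%N.
  move=> iM; rewrite addnC (big_cat_nat (n := size (S p))) ?leq_addr //=.
  congr addn.
    rewrite /C sumnE big_map [RHS](big_nth 0%N) !big_nat; apply: eq_bigr => l /andP[_ lp].
    by rewrite (kappaE p).
  rewrite -{1}[size (S p)]add0n big_addn addKn.
  rewrite (eq_big_nat _ _ (F2 := fun=> c k)) => [|l /andP[_ li]].
    by rewrite sum_nat_const_nat subn0 mulnC.
  by rewrite kappa_blk //; lia.
rewrite [leRHS]big_mkcond !big_nat; apply: ler_sum => i /andP[_ iM].
by rewrite kappa_blk // eqxx CE ?(ltnW iM) // add1n.
Qed.

(** * Linear combinations and inner products on a subspace *)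

(** Closedness here is algebraic, under linear combinations, and not topological. *)
Definition closed_subspace_pred (K : numFieldType) (X : lmodType K)
    (E : X -> Prop) : Prop :=
  E 0 /\ forall (a : K) (x y : X), E x -> E y -> E (a *: x + y).

Lemma closed_subspace_sum (K : numFieldType) (X : lmodType K) (E : X -> Prop)
    (a : nat -> K) (v : nat -> X) (J : nat) :
  closed_subspace_pred E -> (forall j, (j < J)%N -> E (v j)) ->
  E (\sum_(0 <= j < J) a j *: v j).
Proof.
move=> [E0 ED]; elim: J => [|J IH] Ev; first by rewrite big_nil.
rewrite big_nat_recr //= addrC; apply: ED; first exact: Ev.
by apply: IH => j /ltnW; exact: Ev.
Qed.

Lemma span_u_closed (K : numFieldType) (X : lmodType K) (u : nat -> int -> X) :
  closed_subspace_pred (span_u u).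
Proof.
split=> [|a x y [m [c [k [j ->]]]] [m' [c' [k' [j' ->]]]]].
  by exists 0%N, (fun=> 0), (fun=> 0%N), (fun=> 0%N); rewrite big_ord0.
pose glue (V : Type) (f : 'I_m -> V) (g : 'I_m' -> V) (i : 'I_(m + m')) :=
  match fintype.split i with inl i => f i | inr i => g i end.
exists (m + m')%N, (glue K (fun i => a * c i) c'), (glue nat k k'), (glue nat j j').
rewrite big_split_ord scaler_sumr; congr (_ + _); apply: eq_bigr => i _.
  by rewrite /glue (unsplitK (inl i)) scalerA.
by rewrite /glue (unsplitK (inr i)).
Qed.

Lemma span_u_gen (K : numFieldType) (X : lmodType K) (u : nat -> int -> X)
    (k n : nat) : span_u u (u k n).
Proof.
by exists 1%N, (fun=> 1), (fun=> k), (fun=> n); rewrite big_ord1 scale1r.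
Qed.

Lemma linear_map0 (K : numFieldType) (V W : lmodType K) (f : V -> W) :
  is_linear_map f -> f 0 = 0.
Proof. by move=> /(_ (-1) 0 0); rewrite scaler0 addr0 scaleN1r addNr. Qed.

Lemma linear_map_sum (K : numFieldType) (V W : lmodType K) (f : V -> W)
    (a : nat -> K) (v : nat -> V) (J : nat) :
  is_linear_map f ->
  f (\sum_(0 <= j < J) a j *: v j) = \sum_(0 <= j < J) a j *: f (v j).
Proof.
move=> f_lin; elim: J => [|J IH]; first by rewrite !big_nil linear_map0.
by rewrite !big_nat_recr //= addrC f_lin IH addrC.
Qed.

Lemma inner_product_sum (K : numFieldType) (X : lmodType K) (conj : K -> K)
    (E : X -> Prop) (ip : X -> X -> K) (a : nat -> K) (v : nat -> X) (z : X)
    (J : nat) :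
  closed_subspace_pred E -> inner_product_on conj E ip ->
  (forall j, (j < J)%N -> E (v j)) -> E z ->
  ip (\sum_(0 <= j < J) a j *: v j) z = \sum_(0 <= j < J) a j * ip (v j) z.
Proof.
move=> clE [ip_lin _ _]; have [E0 _] := clE.
elim: J => [|J IH] Ev Ez.
  rewrite !big_nil; have := ip_lin (-1) 0 0 z E0 E0 Ez.
  by rewrite scaler0 addr0 mulN1r addNr.
have Ev' j : (j < J)%N -> E (v j) by move=> /ltnW; exact: Ev.
rewrite !big_nat_recr //= addrC ip_lin //; last 2 first.
- exact: Ev.
- exact: closed_subspace_sum.
by rewrite IH // addrC.
Qed.

Lemma inner_product_normC (K : numFieldType) (X : lmodType K) (conj : K -> K)
    (E : X -> Prop) (ip : X -> X -> K) (x y : X) :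
  (forall a, `|conj a| = `|a|) -> inner_product_on conj E ip -> E x -> E y ->
  `|ip y x| = `|ip x y|.
Proof. by move=> conjN [_ ip_sym _] Ex Ey; rewrite ip_sym. Qed.

(** * Almost orthogonal families and a Bessel inequality *)

Lemma norm_mean_square (K : numFieldType) (a b : K) :
  2 * (`|a| * `|b|) <= `|a| ^+ 2 + `|b| ^+ 2.
Proof.
rewrite -subr_ge0 [X in 0 <= X](_ : _ = (`|a| - `|b|) ^+ 2); last by ring.
by rewrite real_exprn_even_ge0 ?rpredB ?normr_real.
Qed.

Lemma natr_half_pow_le1 (K : numFieldType) (J : nat) :
  J%:R * 2^-1 ^+ J.+1 <= 1 :> K.
Proof.
rewrite exprVn ler_pdivrMr ?exprn_gt0 // mul1r -natrX ler_nat.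
by rewrite ltnW // (leq_trans (ltn_expl J (isT : (1 < 2)%N))) // leq_exp2l.
Qed.

(** Induction on [J]: a new vector brings its diagonal term and [J] cross terms of weight at most
    2^-(J+1). This decay keeps the total cost of the cross terms within a constant factor of the
    diagonal sum. *)
Lemma almost_orthogonal_sum (K : numFieldType) (X : lmodType K) (conj : K -> K)
    (E : X -> Prop) (ip : X -> X -> K) (a c : nat -> K) (v : nat -> X)
    (J : nat) :
  (forall a, `|conj a| = `|a|) -> closed_subspace_pred E ->
  inner_product_on conj E ip ->
  (forall j, (j < J)%N -> E (v j)) ->
  (forall j, (j < J)%N -> 1 <= c j) ->
  (forall j, (j < J)%N -> `|ip (v j) (v j)| <= c j) ->
  (forall i j, (i < j)%N -> (j < J)%N -> `|ip (v j) (v i)| <= 2^-1 ^+ j.+1) ->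
  let z := \sum_(0 <= j < J) a j *: v j in
  `|ip z z| <= 3 * \sum_(0 <= j < J) `|a j| ^+ 2 * c j.
Proof.
move=> conjN clE ip_inner; have [ip_lin _ _] := ip_inner; have [E0 ED] := clE.
have sqN_ge0 (b : K) : 0 <= `|b| ^+ 2 by rewrite exprn_ge0.
move=> Ev c1 vc vo /=.
have S_ge0 n : (n <= J)%N -> 0 <= \sum_(0 <= j < n) `|a j| ^+ 2 * c j.
  move=> nJ; rewrite big_nat; apply: sumr_ge0 => j /andP[_ jn].
  by rewrite mulr_ge0 // (le_trans ler01) // c1 // (leq_trans jn).
(* The induction needs the sharper constant 3 - 2^-J: the J-th step costs 2^-(J+1)
   on the previous terms. *)
apply: (@le_trans _ _ ((3 - 2^-1 ^+ J) * \sum_(0 <= j < J) `|a j| ^+ 2 * c j)); last first.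
  by rewrite ler_wpM2r ?S_ge0 // gerBl exprn_ge0 // invr_ge0.
elim: J Ev c1 vc vo S_ge0 => [|J IH] Ev c1 vc vo S_ge0.
  rewrite !big_nil mulr0; have := ip_lin (-1) 0 0 0 E0 E0 E0.
  by rewrite scaler0 addr0 mulN1r addNr => ->; rewrite normr0.
have {}IH := IH (fun j jJ => Ev j (ltnW jJ)) (fun j jJ => c1 j (ltnW jJ))
  (fun j jJ => vc j (ltnW jJ)) (fun i j ij jJ => vo i j ij (ltnW jJ))
  (fun n nJ => S_ge0 n (leqW nJ)).
have Ez := closed_subspace_sum (J := J) a clE (fun j jJ => Ev j (ltnW jJ)).
rewrite !big_nat_recr //=.
set z := \sum_(0 <= j < J) _ *: _ in IH Ez *.
set S := \sum_(0 <= j < J) _ in IH *.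
set e : K := 2^-1 ^+ J.+1.
have e_ge0 : 0 <= e by rewrite exprn_ge0 // invr_ge0.
have e_le1 : e <= 1 by rewrite exprn_ile1 ?invr_ge0 // invf_le1 // ler1n.
have EvJ : E (v J) by exact: Ev.
have cross : `|ip (v J) z| <= e * \sum_(0 <= j < J) `|a j|.
  rewrite -(inner_product_normC (x := v J) (y := z) conjN ip_inner) //.
  rewrite (inner_product_sum a clE ip_inner (fun j jJ => Ev j (ltnW jJ))) //.
  rewrite (le_trans (ler_norm_sum _ _ _)) // mulr_sumr !big_nat.
  apply: ler_sum => j /andP[_ jJ]; rewrite normrM mulrC ler_wpM2r //.
  rewrite -(inner_product_normC conjN ip_inner) ?vo //; exact: Ev (ltnW jJ).
have bound : `|ip (z + a J *: v J) (z + a J *: v J)| <=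
    `|ip z z| + `|a J| ^+ 2 * `|ip (v J) (v J)| + 2 * (`|a J| * `|ip (v J) z|).
  rewrite [z + _]addrC; set w := _ + z.
  have Ew : E w by exact: ED.
  rewrite {1}/w ip_lin // (le_trans (ler_normD _ _)) // normrM.
  rewrite (inner_product_normC (x := w) (y := v J) conjN ip_inner) //.
  rewrite (inner_product_normC (x := w) (y := z) conjN ip_inner) //.
  rewrite /w !ip_lin //.
  have b1 := ler_normD (a J * ip (v J) (v J)) (ip z (v J)).
  have b2 := ler_normD (a J * ip (v J) z) (ip z z).
  apply: (le_trans (lerD (ler_wpM2l (normr_ge0 (a J)) b1) b2)).
  rewrite (inner_product_normC (x := v J) (y := z) conjN ip_inner) // !normrM.
  by rewrite le_eqVlt; apply/orP; left; apply/eqP; ring.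
apply: (le_trans bound).
(* The mean-square inequality splits every cross product. The [J] copies of |a_J|^2 are absorbed by
   J e <= 1 <= c_J, and the other squares cost e S. *)
have cross2 : 2 * (`|a J| * `|ip (v J) z|) <= `|a J| ^+ 2 * c J + e * S.
  apply: (@le_trans _ _ (e * \sum_(0 <= j < J) (`|a J| ^+ 2 + `|a j| ^+ 2))).
    apply: (@le_trans _ _ (e * \sum_(0 <= j < J) 2 * (`|a J| * `|a j|))).
      by rewrite -mulr_sumr -mulr_sumr [leRHS]mulrCA ler_wpM2l // [leRHS]mulrCA ler_wpM2l.
    by rewrite ler_wpM2l //; apply: ler_sum => j _; exact: norm_mean_square.
  rewrite big_split /= mulrDr lerD //.
    rewrite sumr_const_nat subn0 -mulr_natr mulrCA ler_wpM2l // mulrC.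
    by rewrite (le_trans (natr_half_pow_le1 _ _)) // c1.
  rewrite ler_wpM2l // /S !big_nat; apply: ler_sum => j /andP[_ jJ].
  by rewrite ler_peMr // c1 // ltnW.
apply: (le_trans (lerD (lerD IH (ler_wpM2l (sqN_ge0 _) (vc J (ltnSn J)))) cross2)).
have -> : 2^-1 ^+ J = 2 * e :> K by rewrite /e exprS mulrA divff ?mul1r // pnatr_eq0.
(* The bound reached is (3 - 2e) S + 2 |a_J|^2 c_J + e S, against the target (3 - e)(S + |a_J|^2
   c_J). *)
rewrite -subr_ge0.
rewrite [X in 0 <= X](_ : _ = (1 - e) * (`|a J| ^+ 2 * c J)); last by ring.
by rewrite mulr_ge0 ?subr_ge0 // mulr_ge0 // (le_trans ler01) ?c1.
Qed.

(* Test f on z = sum_j a_j v_j with a_j = conj(f(v_j)) / (c_j S), S being the sum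
   to bound: then f z = 1 while |<z, z>| <= 3 / S. *)
Lemma almost_bessel (K : numFieldType) (X : lmodType K) (conj : K -> K)
    (E : X -> Prop) (ip : X -> X -> K) (f : X -> K) (c : nat -> K)
    (v : nat -> X) (delta : K) (J : nat) :
  (forall a, `|conj a| = `|a|) -> closed_subspace_pred E ->
  inner_product_on conj E ip -> @is_linear_map K X K^o f ->
  0 < delta ->
  (forall z, E z -> `|ip z z| < delta -> `|f z| < 1) ->
  (forall j, E (v j)) ->
  (forall j, 1 <= c j) ->
  (forall j, `|ip (v j) (v j)| <= c j) ->
  (forall i j, (i < j)%N -> `|ip (v j) (v i)| <= 2^-1 ^+ j.+1) ->
  \sum_(0 <= j < J) `|f (v j)| ^+ 2 / c j <= 3 / delta.
Proof.
move=> conjN clE ip_inner f_lin delta_gt0 f_bd Ev c1 vc vo.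
have c0 j : 0 < c j by exact: lt_le_trans ltr01 (c1 j).
set S := \sum_(0 <= j < J) _.
have S_ge0 : 0 <= S.
  by apply: sumr_ge0 => j _; rewrite divr_ge0 ?exprn_ge0 // ltW.
rewrite real_leNgt ?ger0_real ?divr_ge0 ?(ltW delta_gt0) //; apply/negP => S_gt.
have S_gt0 : 0 < S by rewrite (le_lt_trans _ S_gt) // divr_ge0 // ltW.
(* The quotient |b|^2 / b stands for the conjugate of b = f(v_j), since [conj] is controlled only
   through its norm; it is 0 when b = 0. *)
pose a j := `|f (v j)| ^+ 2 / f (v j) / c j / S.
have aN j : `|a j| = `|f (v j)| / c j / S.
  rewrite /a !normrM !normfV !normr_id (gtr0_norm (c0 j)) (gtr0_norm S_gt0).
  have [->|fv0] := eqVneq (f (v j)) 0; first by rewrite normr0 !mul0r.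
  by rewrite mulfK // normr_eq0.
have af j : a j * f (v j) = `|f (v j)| ^+ 2 / c j / S.
  rewrite /a; have [->|fv0] := eqVneq (f (v j)) 0.
    by rewrite mulr0 normr0 expr0n /= !mul0r.
  by field; rewrite fv0 !gt_eqF.
have Evs j (_ : (j < J)%N) := Ev j.
have := f_bd _ (closed_subspace_sum a clE Evs).
rewrite (linear_map_sum _ _ _ f_lin) /GRing.scale /= (eq_bigr _ (fun j _ => af j)).
rewrite -mulr_suml divff ?gt_eqF // normr1 ltxx => /(_ _)/negP; apply=> //.
have := almost_orthogonal_sum a conjN clE ip_inner Evs (fun j _ => c1 j)
  (fun j _ => vc j) (fun i j ij _ => vo i j ij).
move=> /le_lt_trans; apply.
(* Here |a_j|^2 c_j = |f(v_j)|^2 / (c_j S^2), whose sum is 1 / S. *)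
rewrite (eq_bigr (fun j => `|f (v j)| ^+ 2 / c j / S ^+ 2)) => [|j _]; last first.
  by rewrite aN; field; rewrite !gt_eqF.
rewrite -mulr_suml -/S [X in X < _](_ : _ = 3 / S); last by field; rewrite gt_eqF.
by rewrite ltr_pdivrMr // mulrC -ltr_pdivrMr.
Qed.

(** * Continuous linear maps and their iterates *)

Lemma continuous_linear_small (K : numFieldType) (X W : normedModType K)
    (f : X -> W) (eps : K) :
  is_linear_map f -> continuous f -> 0 < eps ->
  exists2 delta : K, 0 < delta & forall z, `|z| < delta -> `|f z| < eps.
Proof.
move=> f_lin f_cont eps_gt0.
have /cvgrPdist_lt/(_ _ eps_gt0) := f_cont 0.
rewrite linear_map0 // => /nbhs_ballP[delta /= delta_gt0 H].
exists delta => // z zd; have := H z.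
by rewrite -ball_normE /= !sub0r !normrN; exact.
Qed.

Lemma linear_mapD (K : numFieldType) (V W : lmodType K) (f : V -> W) (x y : V) :
  is_linear_map f -> f (x + y) = f x + f y.
Proof. by move=> f_lin; rewrite -[x in LHS]scale1r f_lin scale1r. Qed.

Lemma linear_map_iter (K : numFieldType) (V : lmodType K) (T : V -> V) (n : nat) :
  is_linear_map T -> is_linear_map (iter n T).
Proof. by move=> T_lin a x y; elim: n => //= n ->. Qed.

Lemma continuous_iter (X : topologicalType) (T : X -> X) (n : nat) :
  continuous T -> continuous (iter n T).
Proof.
move=> T_cont; elim: n => [|n IH] x; first exact: cvg_id.
by apply: (@continuous_comp _ _ _ (iter n T) T x); [exact: IH | exact: T_cont].
Qed.

Lemma iter_shift (X : Type) (T : X -> X) (u : nat -> int -> X) (k n : nat) (z : int) :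
  (forall (k : nat) (n : int), T (u k n) = u k (n + 1)) ->
  iter n T (u k z) = u k (z + n%:Z).
Proof.
move=> Tu; elim: n => [|n IH]; first by rewrite addr0.
by rewrite iterS IH Tu -addrA -[n.+1]addn1 PoszD.
Qed.

(** * Geometric bounds, return times and the vector [x] *)

Lemma half_pow_lt (K : numFieldType) (eps : K) :
  (forall x : K, 0 <= x -> exists n : nat, x < n%:R) -> 0 < eps ->
  exists J : nat, forall j, (J <= j)%N -> 2^-1 ^+ j < eps.
Proof.
move=> arch eps_gt0; have [|n n_gt] := arch eps^-1; first by rewrite invr_ge0 ltW.
exists n => j nj; rewrite exprVn invf_plt ?posrE ?exprn_gt0 //.
rewrite (lt_le_trans n_gt) // -natrX ler_nat ltnW //.
by rewrite (leq_ltn_trans nj) // ltn_expl.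
Qed.

Lemma sum_half_pow_lt (K : numFieldType) (j n : nat) :
  \sum_(j <= l < n) 2^-1 ^+ l.+1 <= 2^-1 ^+ j :> K.
Proof.
have [jn|nj] := leqP j n; last first.
  by rewrite big_geq ?(ltnW nj) // exprn_ge0 // invr_ge0.
have {1}-> : n = (j + (n - j))%N by rewrite subnKC.
suff -> : \sum_(j <= l < j + (n - j)) 2^-1 ^+ l.+1 =
    2^-1 ^+ j - 2^-1 ^+ (j + (n - j)) :> K.
  by rewrite gerBl exprn_ge0 // invr_ge0.
elim: (n - j)%N => [|d IH]; first by rewrite addn0 big_geq // subrr.
rewrite addnS big_nat_recr ?leq_addr //= IH exprS.
by field.
Qed.

(* A6 controls a pair l < m only at later times, so the choice of nu m must
   guarantee that the last clause holds eventually in nu j (clause P6 of the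
   proof); P5 then cashes in this guarantee when nu j is chosen. *)
Lemma return_times (K : numFieldType) (X : normedModType K) (T : X -> X)
    (u : nat -> int -> X) (A : set nat) (ip : X -> X -> K) (kappa : nat -> nat) :
  is_linear_map T -> continuous T -> infinite_set A ->
  (forall k : nat, lim0_along A (fun n => `|u k (- (Posz n))%R|)) ->
  (forall (k a b s : nat), A s ->
      lim0_along A (fun n => ip (u k (Posz n - Posz s)%R) (u a (Posz b)))) ->
  (forall (k m s : nat), A s ->
     forall eps : K, 0 < eps ->
     exists T0 : nat, forall t : nat, A t -> (s < t)%N -> (T0 < t)%N ->
       exists N : nat, forall n : nat, A n -> (t < n)%N -> (N < n)%N ->
         `|ip (u k (Posz n - Posz s)%R) (u m (Posz n - Posz t)%R)| < eps) ->
  exists nu : nat -> nat,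
    [/\ forall i j, (i < j)%N -> (nu i < nu j)%N,
        forall i j, (i < j)%N ->
          `|iter (nu i) T (u (kappa j) (- (nu j)%:Z))| < 2^-1 ^+ j.+1,
        forall j, `|u (kappa j) (- (nu j)%:Z)| < 2^-1 ^+ j.+1,
        forall l i p j, (l < j)%N -> (p < i)%N -> (i < j)%N ->
          `|ip (u (kappa l) (nu j - nu l)%N%:Z) (u (kappa p) (nu i - nu p)%N%:Z)|
            < 2^-1 ^+ j.+1 / (j ^ 2).+1%:R
      & forall l m j, (l < m)%N -> (m < j)%N ->
          `|ip (u (kappa l) (nu j - nu l)%N%:Z) (u (kappa m) (nu j - nu m)%N%:Z)|
            < 2^-1 ^+ m.+1].
Proof.
move=> T_lin T_cont infA A4 A5 A6.
have half_gt0 j : 0 < 2^-1 ^+ j :> K by rewrite exprn_gt0 // invr_gt0.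
pose at_ (s : seq nat) i := nth 0%N s i.
pose G s l m n := `|ip (u (kappa l) (n%:Z - (at_ s l)%:Z))
                       (u (kappa m) (n%:Z - (at_ s m)%:Z))| < 2^-1 ^+ m.+1.
(* Throughout, [s] lists the times already chosen, [size s] is the index j being treated, and [n] is
   the candidate for nu j. *)
pose P1 (s : seq nat) n := forall i, (i < size s)%N -> (at_ s i < n)%N.
pose P2 (s : seq nat) n := forall i, (i < size s)%N ->
  `|iter (at_ s i) T (u (kappa (size s)) (- n%:Z))| < 2^-1 ^+ (size s).+1.
pose P3 (s : seq nat) n := `|u (kappa (size s)) (- n%:Z)| < 2^-1 ^+ (size s).+1.
(* The divisor j^2 + 1 anticipates the expansion of <y_j, y_i> into at most j^2 such products. *)
pose P4 (s : seq nat) n := forall l, (l < size s)%N -> forall i, (i < size s)%N ->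
  forall p, (p < i)%N ->
  `|ip (u (kappa l) (n%:Z - (at_ s l)%:Z)) (u (kappa p) (at_ s i - at_ s p)%N%:Z)|
    < 2^-1 ^+ (size s).+1 / (size s ^ 2).+1%:R.
pose P5 (s : seq nat) n := forall m, (m < size s)%N -> forall l, (l < m)%N ->
  eventually_along A (G s l m) -> G s l m n.
pose P6 (s : seq nat) n := forall l, (l < size s)%N ->
  eventually_along A (G (rcons s n) l (size s)).
pose P s n := P1 s n /\ P2 s n /\ P3 s n /\ P4 s n /\ P5 s n /\ P6 s n.
have [s As|nu Hnu] := @recursive_selection A P infA.
  have Aat i : (i < size s)%N -> A (at_ s i) by move=> i_s; apply/As/mem_nth.
  rewrite /P; do 5 ?[apply: eventually_along_and].
  - apply: eventually_along_forall => i _; exact: eventually_along_gt.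
  - apply: eventually_along_forall => i _.
    have [d d_gt0 Hd] := continuous_linear_small (linear_map_iter (at_ s i) T_lin)
      (continuous_iter (n := at_ s i) T_cont) (half_gt0 (size s).+1).
    have [N HN] := A4 (kappa (size s)) _ d_gt0; exists N => n An Nn.
    by apply: Hd; rewrite -normr_id; exact: HN.
  - have [N HN] := A4 (kappa (size s)) _ (half_gt0 (size s).+1).
    by exists N => n An Nn; rewrite /P3 -normr_id; exact: HN.
  - apply: eventually_along_forall => l ls; apply: eventually_along_forall => i _.
    apply: eventually_along_forall => p _; apply: A5; first exact: Aat.
    by rewrite divr_gt0.
  - apply: eventually_along_forall => m _; apply: eventually_along_forall => l _.
    (* Without the guarantee [P5] is vacuous, so any threshold serves. *)
    have [ev|nev] := pselect (eventually_along A (G s l m)); last by exists 0%N.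
    by apply: eventually_along_imp ev.
  - apply: eventually_along_forall => l ls.
    have [T0 HT0] := A6 (kappa l) (kappa (size s)) _ (Aat l ls) _ (half_gt0 (size s).+1).
    exists (maxn (at_ s l) T0) => t At; rewrite gtn_max => /andP[st T0t].
    have [N HN] := HT0 t At st T0t; exists (maxn t N) => n An.
    rewrite gtn_max => /andP[tn Nn].
    rewrite /G /at_ !nth_rcons ls ltnn eqxx; exact: HN.
have nuA j : A (nu j) by have [] := Hnu j.
have nuE i j : (i < j)%N -> at_ (mkseq nu j) i = nu i by exact: nth_mkseq.
have nuI i j : (i < j)%N -> (nu i < nu j)%N.
  by move=> ij; have [_ [/(_ i) + _]] := Hnu j; rewrite size_mkseq nuE //; exact.
have nuZ i j : (i < j)%N -> (nu j - nu i)%N%:Z = (nu j)%:Z - (nu i)%:Z.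
  by move=> /nuI/ltnW/subzn.
exists nu; split=> //.
- move=> i j ij; have [_ [_ [/(_ i) + _]]] := Hnu j.
  by rewrite size_mkseq nuE //; exact.
- by move=> j; have [_ [_ [_ []]]] := Hnu j; rewrite /P3 size_mkseq.
- move=> l i p j lj pi ij; have [_ [_ [_ [_ [/(_ l) + _]]]]] := Hnu j.
  rewrite size_mkseq => /(_ lj i ij p pi).
  by rewrite !nuE ?(ltn_trans pi ij) // -nuZ.
- move=> l m j lm mj; have [_ [_ [_ [_ [_ [/(_ m) + _]]]]]] := Hnu j.
  rewrite size_mkseq => /(_ mj l lm).
  rewrite /G !nuE ?(ltn_trans lm mj) // -!nuZ ?(ltn_trans lm mj) //; apply.
  (* The guarantee recorded by [P6] at stage [m] is carried over to the longer list of stage [j],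
     which has the same entries at [l] and [m]. *)
  have [_ [_ [_ [_ [_ [_ /(_ l)]]]]]] := Hnu m.
  rewrite size_mkseq => /(_ lm); apply: eventually_along_imp => n _.
  by rewrite /G /at_ !nth_rcons size_mkseq lm ltnn eqxx !nth_mkseq.
Qed.

(** The vector is the norm limit of the partial sums of u_{kappa l, -nu l}. Under T^(nu j) the terms
    l < j shift into E, the term l = j becomes u_{kappa j, 0}, and the terms l > j stay small.
    Replacing [x] by a partial sum and dropping the tail cost at most 2^-j each. *)
Lemma hypercyclic_vector (K : numFieldType) (X : completeNormedModType K)
    (T : X -> X) (u : nat -> int -> X) (kappa nu : nat -> nat) :
  (forall x : K, 0 <= x -> exists n : nat, x < n%:R) ->
  is_linear_map T -> continuous T ->
  (forall (k : nat) (n : int), T (u k n) = u k (n + 1)) ->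
  (forall i j, (i < j)%N -> (nu i < nu j)%N) ->
  (forall i j, (i < j)%N ->
     `|iter (nu i) T (u (kappa j) (- (nu j)%:Z))| < 2^-1 ^+ j.+1) ->
  (forall j, `|u (kappa j) (- (nu j)%:Z)| < 2^-1 ^+ j.+1) ->
  exists x : X, forall j : nat,
    `|iter (nu j) T x - u (kappa j) 0
      - \sum_(0 <= l < j) 1 *: u (kappa l) (nu j - nu l)%N%:Z| <= 2 * 2^-1 ^+ j.
Proof.
move=> arch T_lin T_cont Tu nuI nu_small u_small.
(* The coefficients 1 give the sum the shape of the lemmas on linear combinations. *)
pose S n := \sum_(0 <= l < n) 1 *: u (kappa l) (- (nu l)%:Z).
have S_cvg : cvgn S.
  apply: cauchy_cvg; apply: cauchy_exP => eps eps_gt0.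
  have [J HJ] := half_pow_lt arch eps_gt0.
  exists (S J); exists J => // n /= Jn; rewrite -ball_normE /=.
  have -> : S n = S J + \sum_(J <= l < n) 1 *: u (kappa l) (- (nu l)%:Z).
    exact: big_cat_nat.
  rewrite opprD addNKr normrN.
  apply: le_lt_trans (HJ J (leqnn J)); apply: le_trans (sum_half_pow_lt K J n).
  apply: le_trans (ler_norm_sum _ _ _) _; apply: ler_sum => l _.
  by rewrite scale1r ltW.
exists (lim (S @ \oo)%classic) => j.
set x := lim _; have Tj_lin := linear_map_iter (nu j) T_lin.
have : (iter (nu j) T (S n) @[n --> \oo] --> iter (nu j) T x)%classic.
  by apply: continuous_cvg => //; exact: continuous_iter.
have half_gt0 : 0 < 2^-1 ^+ j :> K by rewrite exprn_gt0 // invr_gt0.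
move=> /cvgrPdist_lt/(_ _ half_gt0)[N _ HN].
pose n := maxn N j.+1; have {HN} := HN n (leq_maxl _ _).
have jn : (j < n)%N by exact: leq_maxr.
have -> : iter (nu j) T (S n) = \sum_(0 <= l < j) 1 *: u (kappa l) (nu j - nu l)%N%:Z
    + u (kappa j) 0
    + \sum_(j.+1 <= l < n) iter (nu j) T (u (kappa l) (- (nu l)%:Z)).
  rewrite (linear_map_sum (W := X)) // (big_cat_nat (n := j.+1)) //= big_nat_recr //=.
  congr (_ + _ + _); last by apply: eq_bigr => l _; rewrite scale1r.
    rewrite !big_nat; apply: eq_bigr => l /andP[_ lj].
    by rewrite (iter_shift _ _ _ Tu) addrC subzn // ltnW // nuI.
  by rewrite scale1r (iter_shift _ _ _ Tu) addNr.
set y := \sum_(0 <= l < j) _; set r := \sum_(j.+1 <= l < n) _ => Hx.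
have -> : iter (nu j) T x - u (kappa j) 0 - y =
    (iter (nu j) T x - (y + u (kappa j) 0 + r)) + r.
  by rewrite !opprD !addrA subrK addrAC.
apply: le_trans (ler_normD _ _) _; rewrite mulrDl mul1r lerD //; first exact: ltW.
apply: le_trans (ler_norm_sum _ _ _) _.
apply: (@le_trans _ _ (2^-1 ^+ j.+1)); last first.
  by rewrite exprS ler_piMl ?(ltW half_gt0) // invf_le1 // ler1n.
apply: le_trans (sum_half_pow_lt K j.+1 n).
rewrite !big_nat; apply: ler_sum => l /andP[jl _]; exact/ltW/nu_small.
Qed.

(** * Weak density of the orbit *)

(** Real and complex scalars are treated at once. As the order of [K] may be partial, negating an
    inequality requires both sides to be real. *)
Lemma theorem4p4_archimedean (K : numFieldType) (conj : K -> K) :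
  (forall x : K, 0 <= x -> exists n : nat, x < n%:R) ->
  (forall a, `|conj a| = `|a|) -> theorem4p4_over conj.
Proof.
move=> arch conjN X T T_lin T_cont u A ip infA u_dense Tu ip_inner ip_strong
  u_back u_bounded A5 A6.
have clE := span_u_closed u.
have [c Hc] : exists c : nat -> nat, forall k n, `|ip (u k n%:Z) (u k n%:Z)| < (c k)%:R.
  suff /choice[c Hc] : forall k, exists c : nat, forall n : nat,
    `|ip (u k n) (u k n)| < c%:R by exists c.
  move=> k; have [M HM] := u_bounded k.
  have [|m Mm] := arch M; first exact: le_trans (HM 0%N).
  by exists m => n; exact: le_lt_trans (HM n) Mm.
have c1 k : 1 <= (c k)%:R :> K.
  by rewrite ler1n -(ltr0n K); exact: le_lt_trans (Hc k 0%N).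
(* The factor 3 comes from [almost_orthogonal_sum], so the denominators below are the bounds [C j]
   on |<y_j, y_j>|. They depend on [kappa] alone, which can thus be fixed before [nu]. *)
have [kappa Hkappa] := harmonically_frequent_sequence K (fun k => 3 * c k)%N.
have [nu [nuI nu_small u_small orth_y orth_u]] :=
  return_times kappa T_lin T_cont infA u_back A5 A6.
have [x Hx] := hypercyclic_vector arch T_lin T_cont Tu nuI nu_small u_small.
pose y j := \sum_(0 <= l < j) 1 *: u (kappa l) (nu j - nu l)%N%:Z.
pose C j : K := (1 + \sum_(0 <= l < j) 3 * c (kappa l))%N%:R.
have Eu k n : span_u u (u k n%:Z) by exact: span_u_gen.
have Ey j : span_u u (y j) by exact: closed_subspace_sum.
have C1 j : 1 <= C j by rewrite ler1n.
have y_norm j : `|ip (y j) (y j)| <= C j.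
  have orth l m : (l < m)%N -> (m < j)%N ->
      `|ip (u (kappa m) (nu j - nu m)%N%:Z) (u (kappa l) (nu j - nu l)%N%:Z)|
        <= 2^-1 ^+ m.+1.
    move=> lm mj; rewrite ltW // (inner_product_normC conjN ip_inner (Eu _ _) (Eu _ _)).
    exact: orth_u.
  apply: le_trans (almost_orthogonal_sum (fun=> 1) (c := fun l => (c (kappa l))%:R)
    conjN clE ip_inner (fun _ _ => Eu _ _) (fun _ _ => c1 _)
    (fun _ _ => ltW (Hc _ _)) orth) _.
  rewrite /C natrD natr_sum mulr_sumr -[leLHS]add0r lerD //.
  by apply: ler_sum => l _; rewrite normr1 expr1n mul1r natrM.
have y_orth i j : (i < j)%N -> `|ip (y j) (y i)| <= 2^-1 ^+ j.+1.
  move=> ij; rewrite (inner_product_sum _ clE ip_inner) //.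
  apply: le_trans (ler_norm_sum _ _ _) _.
  apply: (@le_trans _ _ (\sum_(0 <= l < j) \sum_(0 <= p < j)
      2^-1 ^+ j.+1 / (j ^ 2).+1%:R)); last first.
    rewrite !sumr_const_nat subn0 -mulrnA mulnn -[leLHS]mulr_natr -mulrA ler_piMr //.
    by rewrite mulrC ler_pdivrMr // mul1r ler_nat.
  rewrite big_nat [leRHS]big_nat; apply: ler_sum => l /andP[_ lj].
  rewrite mul1r (inner_product_normC (x := y i) conjN ip_inner) //.
  rewrite (inner_product_sum _ clE ip_inner) //.
  apply: le_trans (ler_norm_sum _ _ _) _.
  rewrite [leRHS](big_cat_nat (n := i)) ?(ltnW ij) //= -[leLHS]addr0.
  rewrite lerD //; last first.
    by apply: sumr_ge0 => p _; rewrite divr_ge0 ?exprn_ge0 // invr_ge0.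
  rewrite !big_nat; apply: ler_sum => p /andP[_ pi].
  rewrite mul1r (inner_product_normC (y := u _ _) conjN ip_inner) // ltW //.
  exact: orth_y.
exists x => z m f f_lc eps eps_gt0.
(* One third each for the error of [x], for y_j, and for approximating [z] by u_{k, 0}. *)
pose e : K := eps / 3; have e_gt0 : 0 < e by rewrite divr_gt0.
have small i : exists J : nat, forall w, `|w| <= 2^-1 ^+ J -> `|f i w| < e.
  have [fl fc] := f_lc i.
  have [d d_gt0 Hd] := continuous_linear_small (W := K^o) fl fc e_gt0.
  have [J HJ] := half_pow_lt arch d_gt0.
  by exists J => w wJ; apply/Hd/(le_lt_trans wJ)/HJ.
have {small}[J HJ] : exists J : nat, forall i w, `|w| <= 2^-1 ^+ J -> `|f i w| < e.
  have [J HJ] := choice small; exists (\max_i J i) => i w /le_trans wJ.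
  by apply: HJ; apply: wJ; rewrite ler_wiXn2l ?invr_ge0 ?invf_le1 ?ler1n ?leq_bigmax.
have half_gt0 : 0 < 2^-1 ^+ J :> K by rewrite exprn_gt0 // invr_gt0.
have [k zk] : exists k, `|u k 0 - z| < 2^-1 ^+ J.
  have [|w [zw [k _ kw]]] := u_dense (ball z (2^-1 ^+ J)) _ (ball_open z _).
    by exists z; exact: ballxx.
  by exists k; move: zw; rewrite -kw -ball_normE /= distrC.
(* The comparison of topologies at 0 makes each functional continuous for the inner product on E. *)
have small_on_E i : exists d : K, 0 < d /\
    forall w, span_u u w -> `|ip w w| < d -> `|f i w| < 1.
  have [fl fc] := f_lc i.
  have [r r_gt0 Hr] := continuous_linear_small (W := K^o) fl fc ltr01.
  have [d d_gt0 Hd] := ip_strong 0 clE.1 r r_gt0; exists d; split=> // w Ew wd.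
  by apply: Hr; rewrite -[w]subr0; apply: Hd; rewrite ?subr0.
have [d Hd] := choice small_on_E.
have bessel i N : \sum_(0 <= j < N) `|f i (y j)| ^+ 2 / C j <= 3 / d i.
  have [d_gt0 fd] := Hd i; have [fl _] := f_lc i.
  exact: almost_bessel conjN clE ip_inner fl d_gt0 fd Ey C1 y_norm y_orth.
suff [j [Jj kj fj]] : exists j, [/\ (J < j)%N, kappa j = k &
    forall i, `|f i (y j)| < e].
  exists (nu j) => i; have [fl _] := f_lc i.
  have := Hx j; rewrite kj -/(y j); set w := _ - y j => w_small.
  have -> : iter (nu j) T x - z = w + y j + (u k 0 - z) by rewrite /w !subrK addrA subrK.
  rewrite (linear_mapD _ (u k 0 - z) fl) (linear_mapD w _ fl).
  rewrite (_ : eps = e + e + e); last by rewrite /e; field.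
  apply: le_lt_trans (ler_normD _ _) _; rewrite ltrD //; last by rewrite HJ // ltW.
  apply: le_lt_trans (ler_normD _ _) _; rewrite ltrD // HJ //.
  (* Since j > J, the error 2 * 2^-j is at most 2^-J. *)
  apply: le_trans w_small _; rewrite -(subnKC Jj) exprD exprS mulrA mulrA divff //.
  by rewrite mul1r ler_piMr ?(ltW half_gt0) // exprn_ile1 ?invr_ge0 // invf_le1 // ler1n.
(* Otherwise every j > J with kappa j = k has some i with |f_i(y_j)| >= e, and then 1 / C_j is at
   most the sum over i of |f_i(y_j)|^2 / (C_j e^2). The Bessel bounds make these terms add up to
   less than [n]. *)
apply: contrapT => no_j.
have [|n Hn] := arch ((\sum_i 3 / d i) / e ^+ 2).
  rewrite divr_ge0 ?exprn_ge0 ?(ltW e_gt0) // sumr_ge0 // => i _.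
  by rewrite divr_ge0 // ltW // (Hd i).1.
have [N] := Hkappa k (J.+1 + n)%N; apply/negP; rewrite -real_ltNge; last 2 first.
- by rewrite ger0_real // sumr_ge0 // => j _; rewrite invr_ge0.
- by rewrite ger0_real.
rewrite natrD.
(* The indicator pays for the indices j <= J, where 1 / C_j <= 1; they contribute at most J + 1 in
   all. *)
apply: (@le_lt_trans _ _ (\sum_(0 <= j < N)
    ((j < J.+1)%N%:R + (\sum_i `|f i (y j)| ^+ 2 / C j) / e ^+ 2))); last first.
  rewrite big_split /= ler_ltD //.
    rewrite -natr_sum ler_nat; elim: (N) => [|N' IH]; first by rewrite big_nil.
    have : (\sum_(0 <= j < N'.+1) (j < J.+1) <= N'.+1)%N.
      rewrite -[leqRHS]subn0 -[leqRHS]muln1 -sum_nat_const_nat.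
      by apply: leq_sum => j _; case: ltnP.
    rewrite !big_nat_recr //=; case: (ltnP N' J.+1) => //; lia.
  rewrite -mulr_suml exchange_big /=; apply: le_lt_trans Hn.
  rewrite ler_wpM2r ?invr_ge0 ?exprn_ge0 ?(ltW e_gt0) //.
  by apply: ler_sum => i _; exact: bessel.
rewrite big_mkcond; apply: ler_sum => j _.
have C_gt0 : 0 < C j by exact: lt_le_trans ltr01 (C1 j).
have term_ge0 i : 0 <= `|f i (y j)| ^+ 2 / C j.
  by rewrite divr_ge0 ?exprn_ge0 // ltW.
have sum_ge0 : 0 <= (\sum_i `|f i (y j)| ^+ 2 / C j) / e ^+ 2.
  by rewrite divr_ge0 ?exprn_ge0 ?(ltW e_gt0) // sumr_ge0.
case: ifP => [/eqP kj|_]; last by rewrite addr_ge0.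
have [jJ|Jj] := ltnP j J.+1.
  rewrite -[leLHS]addr0 lerD // invf_le1 //; exact: C1.
rewrite add0r -/(C j).
have [i fi] : exists i, e <= `|f i (y j)|.
  apply: contrapT => no_i; apply: no_j; exists j; split=> // i.
  rewrite real_ltNge ?normr_real ?gtr0_real //; apply/negP => fi.
  by apply: no_i; exists i.
rewrite ler_pdivlMr ?exprn_gt0 // (bigD1 i) //= -[leLHS]addr0 lerD ?sumr_ge0 //.
by rewrite mulrC ler_wpM2r ?invr_ge0 ?(ltW C_gt0) // lerXn2r // nnegrE ltW.
Qed.

(* Scalars K in {R, C}: both cases, for every model R of the reals. *)
Theorem theorem4p4 (R : realType) :
  theorem4p4_over (K:=R) id /\ theorem4p4_over (K:=R[i]) Num.conj.
Proof.
split; apply: theorem4p4_archimedean => //.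
- by move=> x x_ge0; exists (Num.bound x); exact: archi_boundP.
(* A nonnegative complex number has zero imaginary part, which reduces the claim to the reals. *)
- move=> [a b]; rewrite lecE /= => /andP[/eqP -> a_ge0].
  exists (Num.bound a); rewrite -(rmorph_nat (real_complex R)) ltcR.
  exact: archi_boundP.
- exact: norm_conjC.
Qed.
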